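(* For all integers $d$ and $k$ with $0 \leq k \leq d-2$ and for $\varepsilon \in (0,1)$, there is an $r=r(d,\varepsilon,k) \in \mathbb{N}$ such that for all positive integers $n$ and $m$ there is a set $P$ of $n$ points in $\mathbb{R}^d$ and an arrangement $\mathcal{H}$ of $m$ hyperplanes in $\mathbb{R}^d$ such that $K_{r,r} \not\subseteq G(P,\mathcal{H})$ and the number of incidences between $P$ and $\mathcal{H}$ satisfies \[\mathrm{inc}(P,\mathcal{H}) \geq \Omega_{d,\varepsilon,k}\left(n^{1-(k+1)/((k+2-1/d)(d-k))-\varepsilon}m^{1-(d-1)/(dk+2d-1)-\varepsilon}\right).\]
   Context: An incidence between a point set $P$ and a hyperplane arrangement $\mathcal{H}$ is a pair $(p,H)$ with $p\in P$, $H\in\mathcal{H}$, $p\in H$; $\mathrm{inc}(P,\mathcal{H})$ denotes the number of incidences. $G(P,\mathcal{H})$ is the bipartite incidence graph on $P\cup\mathcal{H}$ with edges $\{p,H\}$ for incidences $(p,H)$. $\Omega_{d,\varepsilon,k}$ hides constants depending on $d,\varepsilon,k$. *)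

(* Defs.v *)
From HB Require Import structures.
From mathcomp Require Import all_boot all_order all_algebra.
From mathcomp Require Import reals exp.
Set Implicit Arguments. Unset Strict Implicit. Unset Printing Implicit Defensive.
Import Order.TTheory GRing.Theory Num.Theory.
Local Open Scope ring_scope.

Definition on_hyp (R : realType) (d : nat) (x : 'rV[R]_d) (h : 'rV[R]_d * R) : bool :=
  \sum_(i < d) h.1 0 i * x 0 i == h.2.

Definition hyp_arrangement (R : realType) (d m : nat) (H : 'I_m -> 'rV[R]_d * R) : Prop :=
  (forall j, (H j).1 != 0) /\
  (forall j j', j != j' -> exists x : 'rV[R]_d, on_hyp x (H j) != on_hyp x (H j')).

Definition inc (R : realType) (d n m : nat) (P : 'I_n -> 'rV[R]_d)
    (H : 'I_m -> 'rV[R]_d * R) : nat :=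
  #|[set ij : 'I_n * 'I_m | on_hyp (P ij.1) (H ij.2)]|.

Definition Krr_sub (R : realType) (d n m : nat) (r : nat) (P : 'I_n -> 'rV[R]_d)
    (H : 'I_m -> 'rV[R]_d * R) : Prop :=
  exists (A : {set 'I_n}) (B : {set 'I_m}),
    #|A| = r /\ #|B| = r /\ forall i j, i \in A -> j \in B -> on_hyp (P i) (H j).

(* Main.v *)
(* Take P in Z^d with |P| about X^(d-k) in a box of side X, with boundedly many
   points on every affine k-flat, and a set W of integral normal vectors of
   height at most Y with |W| about Y^(d(k+1)/(d-1)), boundedly many of which
   lie in any linear subspace of dimension d-k-1.  Then r hyperplanes with
   normals in W meet in a flat of dimension at most k, hence do not share r
   points of P, while all incidences of P with normals in W use only about
   |W| X Y hyperplanes.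

   Both sets come from one random choice: colour well-separated points of a box
   of side L in R^D with about L^(e+epsilon) colours; as an e-flat contains
   O(L^e) of the points, some colouring has no r equally coloured points on an
   e-flat, and the largest class is kept.  For W this is applied in dimension
   D = d-1 to the rational points a/q with q <= Y rescaled by L = Y^(d/(d-1)):
   by Dirichlet's theorem every cell of the grid (Z/L)^D has such a point near
   it, with q comparable to Y for at least half of the cells. *)

Require Import Defs.
From HB Require Import structures.
From mathcomp Require Import all_boot all_order all_algebra.
From mathcomp Require Import reals exp.
From mathcomp Require Import zify ring lra.
Set Implicit Arguments. Unset Strict Implicit. Unset Printing Implicit Defensive.
Import Order.TTheory GRing.Theory Num.Theory.
Local Open Scope ring_scope.

(** * Lattice points close to a flat *)

(* J maximizes the absolute value of the p x p minors; by Cramer's rule every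
   other coordinate has coefficients of absolute value at most 1 on those in J. *)
Lemma dominant_coords (R : realFieldType) (p D : nat) (M : 'M[R]_(p, D)) :
  row_free M ->
  exists J : {ffun 'I_p -> 'I_D}, forall x : 'rV[R]_D, (x <= M)%MS ->
    forall j, `|x 0 j| <= \sum_a `|x 0 (J a)|.
Proof.
move=> freeM.
have fullMT : row_full M^T by rewrite /row_full mxrank_tr.
pose J0 : {ffun 'I_p -> 'I_D} := [ffun a => fullrankfun fullMT a].
pose minor (J : {ffun 'I_p -> 'I_D}) := \det (colsub J M).
have minor0 : minor J0 != 0.
  have -> : minor J0 = \det (rowsub (fullrankfun fullMT) M^T).
    rewrite /minor -det_tr; congr (\det _).
    by apply/matrixP => i j; rewrite !mxE ffunE.
  by rewrite -unitfE -unitmxE -row_full_unit fullrowsub_full.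
pose J := [arg max_(J > J0) `|minor J|]%O.
have maxJ J' : `|minor J'| <= `|minor J|.
  by rewrite /J; case: Order.TotalTheory.arg_maxP => // i _; apply.
have minorJ : 0 < `|minor J|.
  by apply: lt_le_trans (maxJ J0); rewrite normr_gt0.
have unitMJ : colsub J M \in unitmx by rewrite unitmxE unitfE -normr_gt0.
exists J => x /submxP[z ->] j.
set xJ := z *m colsub J M.
have xJE a : (z *m M) 0 (J a) = xJ 0 a.
  by rewrite !mxE; apply: eq_bigr => i _; rewrite !mxE.
pose Q := invmx (colsub J M) *m M.
under eq_bigr do rewrite xJE.
have -> : z *m M = xJ *m Q by rewrite /xJ /Q mulmxA mulmxK.
have Qle a : `|Q a j| <= 1.
  (* Index maps need not be injective, so this replacement always competes with [J]; a repeated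
     column merely gives minor 0. *)
  pose J' : {ffun 'I_p -> 'I_D} := [ffun b => if b == a then j else J b].
  have -> : Q a j = (minor J)^-1 * minor J'.
    rewrite /Q /invmx unitMJ -scalemxAl mxE -/(minor J); congr (_ * _).
    rewrite /minor (expand_det_col _ a) mxE; apply: eq_bigr => i _.
    rewrite !mxE ffunE eqxx mulrC; congr (_ * (_ * \det _)).
    by apply/matrixP => u v; rewrite !mxE !ffunE eq_sym (negPf (neq_lift a v)).
  by rewrite normrM normfV mulrC ler_pdivrMr // mul1r.
rewrite mxE; apply: le_trans (ler_norm_sum _ _ _) _.
apply: ler_sum => a _; rewrite normrM -[leRHS]mulr1.
by rewrite ler_wpM2l.
Qed.

(** A row [(1, v)] is the point [v] in homogeneous coordinates, so the points in a row space of rank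
    e + 1 form a flat of dimension at most e. Column operations clear [v0] and leave the diagonal
    blocks 1 and [X]. *)
Lemma rank_affine_hull (R : fieldType) (p q D : nat) (v0 : 'rV[R]_D)
    (X : 'M[R]_(p, D)) (W : 'M[R]_(q, 1 + D)) :
  (row_mx 1 v0 <= W)%MS -> (row_mx 0 X <= W)%MS -> (\rank X < \rank W)%N.
Proof.
move=> v0W XW.
have : (block_mx 1 v0 0 X <= W)%MS by rewrite /block_mx col_mx_sub v0W XW.
move/mxrankS; apply: leq_trans.
apply: leq_trans (mxrankM_maxl _ (block_mx 1 (- v0) 0 1%:M)).
rewrite mulmx_block !mul1mx !mul0mx !mulmx0 !mulmx1 !addr0 add0r addNr.
by rewrite rank_diag_block_mx mxrank1.
Qed.

(* A point on the flat W is determined by e coordinates of g, up to bounded errors in the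
   others, which are recovered from residues modulo 2 C (e + 1) + 1. *)
Lemma flat_card (R : realFieldType) (D L C e q : nat) (I : finType)
    (g : I -> {ffun 'I_D -> 'I_L}) (v : I -> 'rV[R]_D) (lam : R)
    (W : 'M[R]_(q, 1 + D)) :
  (0 < L)%N -> injective g -> 0 <= lam ->
  (forall i j, `|lam * v i 0 j - (g i j)%:R| <= C%:R) ->
  (\rank W <= e.+1)%N ->
  (#|[set i | (row_mx 1 (v i) <= W)%MS]| <= (2 * C * e.+1).+1 ^ D * L ^ e)%N.
Proof.
move=> L0 ginj lam0 vg rkW; set S := [set i | _].
set De := (2 * C * e.+1)%N.
have [-> | [i0 i0S]] := set_0Vmem S; first by rewrite cards0.
pose X := \matrix_(a < #|S|) (v (enum_val a) - v i0).
have rkX : (\rank X <= e)%N.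
  rewrite -ltnS; apply: leq_trans rkW; apply: (@rank_affine_hull _ _ _ _ (v i0)).
    by move: i0S; rewrite inE.
  apply/row_subP => a; rewrite row_row_mx row0 rowK.
  have -> : row_mx 0 (v (enum_val a) - v i0) =
     row_mx 1 (v (enum_val a)) - row_mx 1 (v i0) :> 'rV_(1 + D).
    by rewrite opp_row_mx add_row_mx subrr.
  rewrite addmx_sub ?eqmx_opp //; last by move: i0S; rewrite inE.
  by have := enum_valP a; rewrite inE.
have inX i : i \in S -> (v i - v i0 <= X)%MS.
  move=> iS; have := row_sub (enum_rank_in i0S i) X.
  by rewrite rowK enum_rankK_in.
have [J JP] := dominant_coords (row_base_free X).
pose pi i := [ffun a => g i (J a)].
pose h i : {ffun 'I_D -> 'I_De.+1} := [ffun j => inord (g i j %% De.+1)].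
have phinj : {in S &, injective (fun i => (pi i, h i))}.
  move=> i i' iS i'S [epi eh]; apply: ginj; apply/ffunP => j; apply: val_inj => /=.
  have dX : (v i - v i' <= row_base X)%MS.
    rewrite eq_row_base; have -> : v i - v i' = (v i - v i0) - (v i' - v i0).
      by rewrite opprB addrA subrK.
    by rewrite addmx_sub ?eqmx_opp ?inX.
  have close a : `|lam * (v i - v i') 0 a - ((g i a)%:R - (g i' a)%:R)| <= 2 * C%:R.
    have -> : lam * (v i - v i') 0 a - ((g i a)%:R - (g i' a)%:R) =
       (lam * v i 0 a - (g i a)%:R) - (lam * v i' 0 a - (g i' a)%:R).
      by rewrite !mxE; ring.
    apply: le_trans (ler_normB _ _) _; rewrite mulr2n mulrDl mul1r.
    exact: lerD (vg _ _) (vg _ _).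
  have small a : lam * `|(v i - v i') 0 (J a)| <= 2 * C%:R.
    have := close (J a); have /ffunP/(_ a) := epi; rewrite !ffunE => ->.
    by rewrite subrr subr0 normrM ger0_norm.
  (* Each of the at most e dominant coordinates contributes 2C, since [g] agrees there, and rounding
     coordinate [j] costs another 2C. The sum [De] is below the modulus, so equal residues force
     equality. *)
  have dj : `|(g i j)%:R - (g i' j)%:R| <= (De%:R : R).
    have : lam * `|(v i - v i') 0 j| <= 2 * C%:R * e%:R.
      apply: (@le_trans _ _ (\sum_(a < \rank X) 2 * C%:R)).
        apply: le_trans (ler_wpM2l lam0 (JP _ dX j)) _.
        by rewrite mulr_sumr; apply: ler_sum.
      rewrite sumr_const card_ord -[leLHS]mulr_natr ler_wpM2l ?ler_nat //.
      by rewrite mulr_ge0 ?ler0n.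
    have := close j; rewrite /De !natrM -[e.+1%:R]natr1.
    have -> : lam * `|(v i - v i') 0 j| = `|lam * (v i - v i') 0 j|.
      by rewrite normrM (ger0_norm lam0).
    set y := lam * _; set z : R := (g i j)%:R - _ => h1 h2.
    apply: le_trans (_ : `|y| + `|y - z| <= _); last by lra.
    by rewrite -{1}(subKr y z) ler_normB.
  have : g i j = g i' j %[mod De.+1].
    move/ffunP/(_ j): eh; rewrite !ffunE => /(congr1 val) /=.
    by rewrite !inordK ?ltn_mod.
  clear -dj; move: (nat_of_ord (g i j)) (nat_of_ord (g i' j)) dj => x y.
  wlog le_yx : x y / (y <= x)%N.
    move=> hw dj exy; case: (leqP y x) => yx; first exact: hw.
    by apply/esym; apply: hw => //; [exact: ltnW | rewrite distrC].
  rewrite -natrB // normr_nat ler_nat => dxy /eqP.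
  rewrite eqn_mod_dvd // => /dvdnP[[|b] xy]; lia.
rewrite -(card_in_imset phinj); apply: leq_trans (max_card _) _.
rewrite card_prod !card_ffun !card_ord mulnC leq_mul2l.
by rewrite leq_pexp2l ?orbT.
Qed.

(** * Random colourings with few points of one colour on a flat *)

Lemma monochromatic_card (I : finType) (K : nat) (B : {set I}) (f0 : 'I_K) :
  #|[set f : {ffun I -> 'I_K} | [forall i in B, f i == f0]]| = (K ^ (#|I| - #|B|))%N.
Proof.
pose F i := if i \in B then pred1 f0 else predT.
have -> : #|[set f : {ffun I -> 'I_K} | [forall i in B, f i == f0]]| = #|family F|.
  rewrite cardsE; apply: eq_card => f; rewrite !inE.
  apply/forall_inP/familyP => [h i|h i iB].
    by rewrite /F; case: ifPn => // /h.
  by have := h i; rewrite /F iB inE.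
rewrite card_family foldrE big_map big_enum /=.
rewrite (bigID (mem B)) /= big1 => [|i iB]; last by rewrite /F iB card1.
rewrite mul1n (eq_bigr (fun=> K)); last first.
  by move=> i iB; rewrite /F (negPf iB) card_ord.
rewrite prod_nat_const; congr (_ ^ _)%N.
by rewrite -(cardsC B) addKn; apply: eq_card => i; rewrite !inE.
Qed.

Lemma card_bigcup_le (I T : finType) (P : pred I) (F : I -> {set T}) :
  (#|\bigcup_(i | P i) F i| <= \sum_(i | P i) #|F i|)%N.
Proof.
elim/big_rec2: _ => [|i n A _ leAn]; first by rewrite cards0.
by apply: leq_trans (leq_card_setU _ _) _; rewrite leq_add2l.
Qed.

(** Union bound: each member of [F] is monochromatic in K * K^(|I| - r) colourings, and fewer than
    K^(r-1) members cannot exhaust all K^|I| of them. *)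
Lemma proper_coloring (I : finType) (K r : nat) (F : {set {set I}}) :
  (0 < K)%N -> (0 < r)%N -> (forall B, B \in F -> #|B| = r) ->
  (#|F| < K ^ r.-1)%N ->
  exists f : {ffun I -> 'I_K}, forall B f0, B \in F ->
    exists2 i, i \in B & f i != f0.
Proof.
move=> K0 r0 cardF ltF.
pose bad := \bigcup_(B in F) \bigcup_(c : 'I_K)
   [set f : {ffun I -> 'I_K} | [forall i in B, f i == c]].
suff : ~: bad != set0.
  case/set0Pn => f; rewrite inE => fgood; exists f => B c BF.
  apply/exists_inP; rewrite -negb_forall_in; apply: contra fgood => fB.
  by apply/bigcupP; exists B => //; apply/bigcupP; exists c; rewrite ?inE.
rewrite -card_gt0 cardsCs setCK subn_gt0.
(* A member of [F] witnesses r <= |I|, which the truncated exponent |I| - r requires. *)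
have [F0 | [B0 B0F]] := set_0Vmem F.
  by rewrite /bad F0 big_set0 cards0 card_ffun card_ord expn_gt0 K0.
have rI : (r <= #|I|)%N by rewrite -(cardF _ B0F) max_card.
apply: (@leq_ltn_trans (\sum_(B in F) K * K ^ (#|I| - r))%N).
  apply: leq_trans (card_bigcup_le _ _) _; apply: leq_sum => B BF.
  apply: leq_trans (card_bigcup_le _ _) _.
  rewrite -[X in (_ <= X * _)%N]card_ord -sum_nat_const; apply: leq_sum => c _.
  by rewrite monochromatic_card cardF.
rewrite sum_nat_const card_ffun card_ord.
have -> : #|I| = (r.-1 + (#|I| - r).+1)%N by lia.
have -> : ((r.-1 + (#|I| - r).+1) - r)%N = (#|I| - r)%N by lia.
by rewrite expnD expnS ltn_pmul2r // muln_gt0 K0 expn_gt0 K0.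
Qed.

Lemma bin_leq_expn (n r : nat) : ('C(n, r) <= n ^ r)%N.
Proof.
have ffactle m : (n ^_ m <= n ^ m)%N.
  by elim: m => // m IH; rewrite ffactnSr expnSr leq_mul ?leq_subr.
by apply: leq_trans (ffactle r); rewrite -bin_ffact leq_pmulr ?fact_gt0.
Qed.

(** A set of rank at most e + 1 lies in the span of e + 1 of its points: choose these points, then r
    of the at most T points in their span. *)
Lemma flat_subsets_card (F : fieldType) (N e r T : nat) (I : finType)
    (u : I -> 'rV[F]_N) :
  (0 < r)%N ->
  (forall W : 'M[F]_N, (\rank W <= e.+1)%N -> #|[set i | (u i <= W)%MS]| <= T)%N ->
  (#|[set B : {set I} | (#|B| == r) && (\rank (\sum_(i in B) <<u i>>)%MS <= e.+1)]|
     <= #|I| ^ e.+1 * T ^ r)%N.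
Proof.
move=> r0 cardW.
pose Wb (b : {ffun 'I_e.+1 -> I}) := (\sum_a <<u (b a)>>)%MS.
pose Sb b := [set B : {set I} | B \subset [set i | (u i <= Wb b)%MS] & #|B| == r].
apply: (@leq_trans #|\bigcup_b Sb b|); last first.
  apply: leq_trans (card_bigcup_le _ _) _.
  rewrite -[X in (_ <= X ^ _ * _)%N]/(#|I|) -[X in (_ <= _ ^ X * _)%N]card_ord.
  rewrite -card_ffun -sum_nat_const; apply: leq_sum => b _.
  rewrite cards_draws; apply: leq_trans (bin_leq_expn _ _) _.
  rewrite leq_exp2r // cardW //.
  apply: leq_trans (mxrank_sum_leqif _) _.
  rewrite -[X in (_ <= X)%N](card_ord e.+1) -sum1_card; apply: leq_sum => a _.
  by rewrite /= mxrank_gen rank_leq_row.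
apply/subset_leq_card/subsetP => B; rewrite inE => /andP[/eqP cardB rkB].
have [i0 i0B] : exists i0, i0 \in B by apply/set0Pn; rewrite -card_gt0 cardB.
pose A := \matrix_(a < #|B|) u (enum_val a).
have uA i : i \in B -> (u i <= A)%MS.
  move=> iB; have := row_sub (enum_rank_in i0B i) A.
  by rewrite rowK enum_rankK_in.
have rkA : (\rank A <= e.+1)%N.
  apply: leq_trans rkB; apply/mxrankS/row_subP => a; rewrite rowK.
  by apply: (sumsmx_sup (enum_val a)); [exact: enum_valP | rewrite genmxE].
(* A basis chosen among the points of [B], padded with [i0] when the rank is below e + 1. *)
pose b : {ffun 'I_e.+1 -> I} := [ffun a : 'I_e.+1 =>
  if insub (a : nat) is Some a' then enum_val (maxrankfun A a') else i0].
apply/bigcupP; exists b => //; rewrite inE cardB eqxx andbT.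
apply/subsetP => i iB; rewrite inE; apply: submx_trans (uA i iB) _.
rewrite -(eq_maxrowsub A); apply/row_subP => a; rewrite row_rowsub rowK.
apply: (sumsmx_sup (widen_ord rkA a)) => //.
by rewrite ffunE /= valK genmxE.
Qed.

(** A colouring leaves no degenerate r-set monochromatic; by pigeonhole some colour class has at
    least |I| / K points, and r of them on one flat would form such a set. *)
Lemma subset_avoiding_flats (F : fieldType) (N e r T K : nat) (I : finType)
    (u : I -> 'rV[F]_N) :
  (0 < r)%N -> (0 < K)%N ->
  (forall W : 'M[F]_N, (\rank W <= e.+1)%N -> #|[set i | (u i <= W)%MS]| <= T)%N ->
  (#|I| ^ e.+1 * T ^ r < K ^ r.-1)%N ->
  exists S : {set I}, (#|I| <= #|S| * K)%N /\
    forall W : 'M[F]_N, (\rank W <= e.+1)%N -> (#|[set i in S | (u i <= W)%MS]| < r)%N.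
Proof.
move=> r0 K0 cardW ltK.
set Fl := [set B : {set I} | (#|B| == r) && (\rank (\sum_(i in B) <<u i>>)%MS <= e.+1)%N].
have cardFl B : B \in Fl -> #|B| = r by rewrite inE => /andP[/eqP].
have [f fP] := proper_coloring K0 r0 cardFl
  (leq_ltn_trans (flat_subsets_card r0 cardW) ltK).
pose cl c := [set i | f i == c].
have [c cP] : exists c, (#|I| <= #|cl c| * K)%N.
  apply/existsP; apply: contraT => /existsPn hc.
  have : (#|I| * K <= \sum_(c : 'I_K) #|cl c| * K)%N.
    rewrite -big_distrl leq_mul2r /= -[X in (X <= _)%N]sum1_card.
    rewrite (partition_big f predT) //=; apply/orP; right; apply: leq_sum => c _.
    by rewrite sum1dep_card.
  move=> h; have : (\sum_(c : 'I_K) #|cl c| * K < \sum_(c : 'I_K) #|I|)%N.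
    rewrite (bigD1 (Ordinal K0)) //= [X in (_ < X)%N](bigD1 (Ordinal K0)) //=.
    rewrite -addSn leq_add ?leq_sum ?ltnNge //.
    by move=> i _; apply: ltnW; rewrite ltnNge.
  by rewrite sum_nat_const card_ord mulnC ltnNge h.
exists (cl c); split => // W rkW; rewrite ltnNge; apply/negP => rle.
have [B [sB cB]] : exists B : {set I}, B \subset [set i in cl c | (u i <= W)%MS] /\ #|B| = r.
  have : (0 < #|[set B : {set I} | B \subset [set i in cl c | (u i <= W)%MS] & #|B| == r]|)%N.
    by rewrite cards_draws bin_gt0.
  by rewrite card_gt0 => /set0Pn[B]; rewrite inE => /andP[? /eqP]; exists B.
have BFl : B \in Fl.
  rewrite inE cB eqxx; apply: leq_trans rkW; apply/mxrankS/sumsmx_subP => i iB.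
  by rewrite genmxE; move/subsetP/(_ _ iB): sB; rewrite !inE => /andP[].
have [i iB] := fP B c BFl.
by move/subsetP/(_ _ iB): sB; rewrite !inE => /andP[->].
Qed.

(** The side is an s-th power so that L^(e + 1/s) = l^(s e + 1) is an integer; up to a constant this
    is the number of colours, one factor l more than the order of the number of points on an
    e-flat. *)
Lemma lattice_packing (R : realFieldType) (D C e s : nat) :
  exists r K0 : nat, [/\ (0 < r)%N, (0 < K0)%N &
  forall (l L : nat) (I : finType) (g : I -> {ffun 'I_D -> 'I_L})
    (v : I -> 'rV[R]_D) (lam : R),
  (0 < l)%N -> L = (l ^ s)%N -> injective g -> 0 <= lam ->
  (forall i j, `|lam * v i 0 j - (g i j)%:R| <= C%:R) ->
  exists S : {set I}, (#|I| <= #|S| * (K0 * l ^ (s * e).+1))%N /\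
    forall W : 'M[R]_(1 + D), (\rank W <= e.+1)%N ->
      (#|[set i in S | (row_mx 1 (v i) <= W)%MS]| < r)%N].
Proof.
have [t tE] : exists t, t = ((2 * C * e.+1).+1 ^ D)%N by eexists.
(* With r = p + 1, the surplus factor l^p in K^(r-1) pays for the |I|^(e+1) choices of spanning
   points and for one more l^(s e); the factor 2 t^2 in K pays for t^r. *)
pose p := (s * D * e.+1 + s * e).+1.
have t0 : (0 < t)%N by rewrite tE expn_gt0.
exists p.+1, (2 * t ^ 2)%N; split => // [|l L I g v lam l0 LE ginj lam0 vg].
  by rewrite muln_gt0 expn_gt0 t0.
subst L; have ls0 : (0 < l ^ s)%N by rewrite expn_gt0 l0.
apply: (@subset_avoiding_flats _ _ e _ (t * (l ^ s) ^ e)%N) => // [|W rkW|].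
- by rewrite !muln_gt0 !expn_gt0 t0 l0.
- rewrite tE; exact: (flat_card ls0 ginj lam0 vg rkW).
have cardI : (#|I| <= l ^ (s * D))%N.
  by have := leq_card g ginj; rewrite card_ffun !card_ord -expnM.
rewrite /= -expnM !expnMn -!expnM.
apply: (@leq_ltn_trans (l ^ ((s * e).+1 * p) * t ^ p.+1)%N).
  rewrite mulnCA mulnC leq_mul2r; apply/orP; right.
  apply: (@leq_trans (l ^ (s * D * e.+1) * l ^ (s * e * p.+1)))%N.
    by rewrite leq_mul2r [X in (_ <= X)%N]expnM leq_exp2r // cardI orbT.
  by rewrite -expnD leq_pexp2l // /p; nia.
rewrite mulnC ltn_pmul2r ?expn_gt0 ?l0 //.
apply: (@leq_ltn_trans (t ^ (2 * p))%N); first by rewrite leq_pexp2l // /p; nia.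
by rewrite -expnD addnn -mul2n ltn_Pmull ?expn_gt0 ?t0 //; rewrite -{1}(expn0 2) ltn_exp2l.
Qed.

(** * Simultaneous approximation with large denominators *)

(** There are q + 1 values of a, and for each the multiples q x lie in a window of length 2T, which
    holds at most 2T/q + 1 of them. As 1 <= q <= T, the product is at most 6T. *)
Lemma near_multiples_card (q T L : nat) :
  (0 < q)%N -> (q <= T)%N ->
  (#|[set x : 'I_L | [exists a : 'I_q.+1, (q * x < a * L + T) && (a * L < q * x + T)]]|
    <= 6 * T)%N.
Proof.
move=> q0 qT; set S := [set x | _].
pose witness x := [pick a : 'I_q.+1 | (q * x < a * L + T) && (a * L < q * x + T)]%N.
pose h (x : 'I_L) : 'I_q.+1 * 'I_(2 * T %/ q).+1 :=
  let a := odflt ord0 (witness x) in (a, inord ((q * x + T - a * L) %/ q)).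
have hinj : {in S &, injective h}.
  have wit x : x \in S -> exists2 a : 'I_q.+1, witness x = Some a &
      ((q * x < a * L + T) && (a * L < q * x + T))%N.
    rewrite inE => /existsP[a0 a0P]; rewrite /witness.
    by case: pickP => [a aP|/(_ a0)]; [exists a | rewrite a0P].
  move=> x y /wit[a wx /andP[x1 x2]] /wit[b wy /andP[y1 y2]].
  rewrite /h wx wy /= => -[eab]; subst b => /(congr1 val) /=.
  have small z : (q * z < a * L + T)%N -> ((q * z + T - a * L) %/ q < (2 * T %/ q).+1)%N.
    by move=> zl; rewrite ltnS leq_div2r //; lia.
  rewrite !inordK ?small // => e; apply: val_inj => /=.
  move: (nat_of_ord x) (nat_of_ord y) x2 y2 e => {wx wy x1 y1}x {}y x2 y2 e.
  wlog le_xy : x y x2 y2 e / (x <= y)%N.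
    move=> hw; case: (leqP x y) => xy; first exact: hw.
    by apply/esym/hw => //; exact: ltnW.
  have : (q * y + T - a * L = q * (y - x) + (q * x + T - a * L))%N.
    by rewrite mulnBr; have := leq_mul (leqnn q) le_xy; lia.
  move=> ey; move: e; rewrite ey [(q * (y - x))%N]mulnC divnMDl //; lia.
rewrite -(card_in_imset hinj); apply: leq_trans (max_card _) _.
rewrite card_prod !card_ord mulnS mulSn.
have : (q * (2 * T %/ q) <= 2 * T)%N by rewrite mulnC leq_divM.
have : (2 * T %/ q <= 2 * T)%N by rewrite leq_div.
lia.
Qed.

(** Dirichlet's pigeonhole argument: the residues modulo L = t T of the multiples q c, for 0 <= q <=
    T = t^D, fall into t^D boxes of side T, so two of the T + 1 multiples share a box. *)
Lemma simultaneous_approximation (D t : nat) (c : 'I_D -> nat) :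
  (0 < t)%N ->
  exists (q : nat) (a : 'I_D -> nat), (0 < q <= t ^ D)%N /\
    forall j, (q * c j < a j * t ^ D.+1 + t ^ D)%N /\ (a j * t ^ D.+1 < q * c j + t ^ D)%N.
Proof.
move=> t0; set T := (t ^ D)%N; set L := (t ^ D.+1)%N.
have T0 : (0 < T)%N by rewrite expn_gt0 t0.
have LE : L = (t * T)%N by rewrite /L expnS.
have L0 : (0 < L)%N by rewrite LE muln_gt0 t0.
pose box (q : 'I_T.+1) : {ffun 'I_D -> 'I_t.-1.+1} :=
  [ffun j => inord ((q * c j) %% L %/ T)].
have /injectivePn[q1 [q2 neq ebox]] : ~~ injectiveb box.
  apply/negP => /injectiveP/leq_card.
  by rewrite card_ffun !card_ord prednK // ltnn.
wlog lt12 : q1 q2 neq ebox / (q1 < q2)%N.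
  move=> hw; case: (ltngtP q1 q2) => [h|h|/val_inj h]; first exact: (hw q1 q2).
    by apply: (hw q2 q1) => //; rewrite eq_sym.
  by rewrite h eqxx in neq.
exists (q2 - q1)%N, (fun j => q2 * c j %/ L - q1 * c j %/ L)%N; split.
  by rewrite subn_gt0 lt12 /= (leq_trans (leq_subr _ _)) // -ltnS.
move=> j; move/ffunP/(_ j): ebox; rewrite !ffunE => /(congr1 val) /=.
have small q : ((q * c j) %% L %/ T < t.-1.+1)%N.
  by rewrite prednK // ltn_divLR // -LE ltn_mod.
rewrite !inordK // => edv.
have := divn_eq (q1 * c j) L; have := divn_eq (q2 * c j) L.
have le12 : (q1 * c j %/ L <= q2 * c j %/ L)%N.
  by rewrite leq_div2r // leq_mul2r (ltnW lt12) orbT.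
have := divn_eq ((q1 * c j) %% L) T; have := divn_eq ((q2 * c j) %% L) T.
rewrite edv; have := ltn_mod ((q1 * c j) %% L) T; have := ltn_mod ((q2 * c j) %% L) T.
rewrite T0; move: (_ %% T)%N (_ %% T)%N => x y hx hy -> ->.
have : (q1 * c j <= q2 * c j)%N by rewrite leq_mul2r (ltnW lt12) orbT.
rewrite !mulnBl; have := leq_mul le12 (leqnn L).
lia.
Qed.

(* For a given q, at most (6 t^D)^D cells have an approximation with denominator q,
   so at most half of the t^(D(D+1)) cells have one with q < t^D / (2 * 6^D). *)
Lemma large_denominators (D t : nat) :
  (0 < t)%N ->
  exists S : {set {ffun 'I_D -> 'I_(t ^ D.+1)}},
    ((t ^ D.+1) ^ D <= 2 * #|S|)%N /\
    forall c, c \in S -> exists (q : nat) (a : 'I_D -> nat),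
      [/\ (0 < q <= t ^ D)%N, (t ^ D <= 2 * 6 ^ D * q)%N &
       forall j, [/\ a j <= q, q * c j < a j * t ^ D.+1 + t ^ D
                  & a j * t ^ D.+1 < q * c j + t ^ D]%N].
Proof.
move=> t0; set T := (t ^ D)%N; set L := (t ^ D.+1)%N; set ka := (2 * 6 ^ D)%N.
have T0 : (0 < T)%N by rewrite expn_gt0 t0.
have ka0 : (0 < ka)%N by rewrite muln_gt0 expn_gt0.
have L0 : (0 < L)%N by rewrite expn_gt0 t0.
have TL : (T <= L)%N by rewrite leq_pexp2l.
pose near (q : nat) := [set x : 'I_L |
  [exists a : 'I_q.+1, (q * x < a * L + T) && (a * L < q * x + T)]]%N.
pose small := [set q : 'I_T.+1 | (0 < q) && (ka * q < T)]%N.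
pose bad := \bigcup_(q in small) [set c : {ffun 'I_D -> 'I_L} | c \in ffun_on (near q)].
exists (~: bad); split.
  have card_small : (#|small| * ka <= T)%N.
    have : (#|small| <= T %/ ka)%N.
      have small_sub : small \subset [set inord (val i).+1 | i : 'I_(T %/ ka)].
        apply/subsetP => q; rewrite inE => /andP[q0 qT].
        have qlt : (q.-1 < T %/ ka)%N.
          by rewrite -ltnS prednK // ltnS leq_divRL // mulnC ltnW.
        apply/imsetP; exists (Ordinal qlt) => //=; apply: val_inj => /=.
        by rewrite inordK prednK.
      apply: leq_trans (subset_leq_card small_sub) _.
      by apply: leq_trans (leq_imset_card _ _) _; rewrite card_ord.
    by move=> h; apply: leq_trans (leq_divM T ka); rewrite leq_mul2r h orbT.
  have card_bad : (2 * #|bad| <= L ^ D)%N.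
    apply: (@leq_trans (2 * (#|small| * (6 * T) ^ D))%N).
      rewrite leq_mul2l /=; apply: leq_trans (card_bigcup_le _ _) _.
      rewrite -sum_nat_const; apply: leq_sum => q; rewrite inE => /andP[q0 qT].
      rewrite cardsE card_ffun_on card_ord; have powle m n : (m <= n -> m ^ D <= n ^ D)%N.
        by move=> mn; elim: (D) => // e IH; rewrite !expnS leq_mul.
      by apply: powle; apply: near_multiples_card => //; rewrite -ltnS.
    (* The factor T absorbs 2 * 6^D times the number of small denominators, by [card_small]. *)
    have -> : (L ^ D = T * T ^ D)%N by rewrite /L /T -!expnM -expnD mulSn.
    rewrite expnMn mulnA mulnA leq_mul2r; apply/orP; right.
    by rewrite -mulnA mulnCA.
  have := cardsC bad; rewrite card_ffun !card_ord -/L.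
  move: #|bad| #|~: bad| (L ^ D)%N card_bad => x y z. lia.
move=> c; rewrite inE => cgood.
have [q [a [/andP[q0 qT] aP]]] := simultaneous_approximation (fun j => c j) t0.
have aq j : (a j <= q)%N.
  have [_] := aP j; rewrite -/L -/T => h.
  have : (a j * L < q.+1 * L)%N.
    apply: (leq_trans h); rewrite mulSn addnC leq_add // leq_mul //.
    exact: ltnW.
  by rewrite ltn_pmul2r.
exists q, a; split; first by rewrite q0.
  rewrite leqNgt; apply: contra cgood => qlt.
  apply/bigcupP; exists (inord q); rewrite !inE inordK ?ltnS ?q0 //.
  apply/ffun_onP => j; rewrite inE; apply/existsP.
  by exists (inord (a j)); rewrite inordK ?ltnS //; have [-> ->] := aP j.
by move=> j; have [? ?] := aP j.
Qed.

(** * The two packings: normal vectors and points *)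

(** Keeps one representative per fibre. It is needed because different grid cells may receive the
    same rational point. *)
Lemma injective_transversal (I : finType) (T : eqType) (f : I -> T) (r : nat)
    (S : {set I}) :
  (forall y, #|[set i in S | f i == y]| <= r)%N ->
  exists S' : {set I}, [/\ S' \subset S, {in S' &, injective f} & (#|S| <= #|S'| * r)%N].
Proof.
move=> fib; pose rep i := odflt i [pick j in S | f j == f i].
have repP i : i \in S -> (rep i \in S) /\ f (rep i) = f i.
  move=> iS; rewrite /rep; case: pickP => [j /andP[jS /eqP]|h] //=.
have repE i j : i \in S -> j \in S -> f i = f j -> rep i = rep j.
  move=> iS jS e; rewrite /rep e; case: pickP => // /(_ j).
  by rewrite jS eqxx.
exists (rep @: S); split.
- by apply/subsetP => _ /imsetP[i iS ->]; have [] := repP i iS.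
- move=> _ _ /imsetP[i iS ->] /imsetP[j jS ->].
  by rewrite (repP i iS).2 (repP j jS).2; exact: repE.
rewrite -sum_nat_const -[X in (X <= _)%N]sum1_card.
rewrite (partition_big rep (fun y => y \in rep @: S)) /=; last first.
  by move=> i iS; apply: imset_f.
apply: leq_sum => y _; apply: leq_trans (fib (f y)).
rewrite sum1dep_card; apply/subset_leq_card/subsetP => i; rewrite !inE.
by case/andP => iS /eqP <-; rewrite iS (repP i iS).2 eqxx.
Qed.

(** The packing runs on the grid of side L = l^s with l = t^(D+1), where heights are at most t^(sD).
    Dividing L^D cells by about l^(s e + 1) colours leaves the exponent (D+1)(s(D-e) - 1). *)
Lemma normal_packing (R : realFieldType) (D e s : nat) :
  (e < D)%N -> (0 < s)%N ->
  exists r K : nat, (0 < K)%N /\ forall t : nat, (0 < t)%N ->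
  exists (N : nat) (w : 'I_N -> 'rV[R]_(1 + D)) (q : 'I_N -> nat) (a : 'I_N -> 'I_D -> nat),
    [/\ (t ^ (D.+1 * (s * (D - e) - 1)) <= K * N)%N,
        (N <= t ^ (D.+1 * (s * (D - e) - 1)))%N,
        injective w,
        forall i, [/\ w i = row_mx 1 (\row_j ((a i j)%:R / (q i)%:R)),
                     (0 < q i <= t ^ (s * D))%N & forall j, (a i j <= q i)%N]
      & forall W : 'M[R]_(1 + D), (\rank W <= e.+1)%N ->
          (#|[set i | (w i <= W)%MS]| < r)%N].
Proof.
move=> eD s0; have [r [K0 [r0 K0p pack]]] := @lattice_packing R D (2 * 6 ^ D) e s.
exists r, (2 * (r * K0))%N; split; first by rewrite !muln_gt0 r0.
move=> t t0; set F := (D.+1 * _)%N.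
have ts0 : (0 < t ^ s)%N by rewrite expn_gt0 t0.
have [S [cardS SP]] := large_denominators D ts0.
pose I := {c | c \in S}.
have [q qP] := fin_all_exists (fun c : I => SP _ (valP c)).
have [a aP] := fin_all_exists qP.
set L := ((t ^ s) ^ D.+1)%N in S cardS SP I q qP a aP.
have LE : L = ((t ^ D.+1) ^ s)%N by rewrite /L -!expnM mulnC.
pose v (c : I) := \row_j ((a c j)%:R / (q c)%:R) : 'rV[R]_D.
have l0 : (0 < t ^ D.+1)%N by rewrite expn_gt0 t0.
(* The error T/q is bounded by a constant exactly because q is comparable to T = t^(sD). *)
have vclose (c : I) j : `|L%:R * v c 0 j - (val c j)%:R| <= (2 * 6 ^ D)%:R.
  have [/andP[q0 _] Tq /(_ j)[_ lo hi]] := aP c.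
  have qR0 : 0 < (q c)%:R :> R by rewrite ltr0n.
  have -> : L%:R * v c 0 j - (val c j)%:R =
     ((a c j * L)%:R - (q c * val c j)%:R) / (q c)%:R :> R.
    by rewrite mxE !natrM; field; rewrite gt_eqF.
  rewrite normrM normfV (gtr0_norm qR0) ler_pdivrMr // -natrM.
  apply: le_trans (_ : ((t ^ s) ^ D)%:R <= _); last by rewrite ler_nat.
  rewrite ler_distl lerBlDr -!natrD !ler_nat; apply/andP; split; lia.
have [S1 [cardS1 S1P]] := pack _ _ _ _ v L%:R l0 LE val_inj (ler0n _ _) vclose.
pose u (c : I) : 'rV[R]_(1 + D) := row_mx 1 (v c).
(* Cells with the same point lie in a space of rank at most 1, so the packing bound applies to
   them. *)
have fib y : (#|[set c in S1 | u c == y]| <= r)%N.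
  have rky : (\rank <<y>>%MS <= e.+1)%N.
    by rewrite mxrank_gen; apply: leq_trans (rank_leq_row _) _.
  apply: leq_trans (ltnW (S1P _ rky)); apply/subset_leq_card/subsetP => c.
  by rewrite !inE => /andP[-> /eqP <-]; rewrite genmxE submx_refl.
have [S2 [sub2 uinj cardS2]] := injective_transversal fib.
have F_le : (t ^ F <= 2 * (r * K0) * #|S2|)%N.
  have : (t ^ (F + D.+1 * (s * e).+1) <= 2 * (r * K0) * #|S2| * t ^ (D.+1 * (s * e).+1))%N.
    have -> : (F + D.+1 * (s * e).+1 = D.+1 * (s * D))%N.
      rewrite /F -mulnDr; congr (_ * _)%N.
      have : (0 < s * (D - e))%N by rewrite muln_gt0 s0 subn_gt0.
      have : (s * e < s * D)%N by rewrite ltn_pmul2l.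
      rewrite mulnBr; lia.
    have -> : (t ^ (D.+1 * (s * D)) = L ^ D)%N by rewrite LE -!expnM mulnA.
    apply: leq_trans cardS _; rewrite -!mulnA leq_mul2l /=.
    move: cardS1; rewrite card_sig => /leq_trans; apply.
    rewrite -expnM; apply: leq_trans (leq_mul cardS2 (leqnn _)) _.
    by apply/eq_leq; ring.
  by rewrite expnD leq_pmul2r // expn_gt0 t0.
(* Truncation supplies the upper bound on N that later limits the number of hyperplanes. *)
pose N := minn #|S2| (t ^ F).
have NS : (N <= #|S2|)%N by rewrite geq_minl.
pose c_ (i : 'I_N) : I := enum_val (widen_ord NS i).
have c_inj : injective c_.
  by move=> i j /enum_val_inj/(congr1 val)/= h; apply: val_inj.
have cS i : c_ i \in S2 by exact: enum_valP.
exists N, (u \o c_), (q \o c_), (a \o c_); split => //=.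
- rewrite /N /minn; case: ifP => // _.
  by rewrite leq_pmull // !muln_gt0 r0.
- exact: geq_minr.
- by move=> i j /= /uinj h; apply: c_inj; exact: h.
- move=> i; have [qi _ ai] := aP (c_ i).
  split => //; first by rewrite expnM.
  by move=> j; have [] := ai j.
move=> W /S1P; apply: leq_ltn_trans.
rewrite -(card_imset _ c_inj); apply/subset_leq_card/subsetP => _ /imsetP[i iW ->].
by rewrite inE (subsetP sub2 _ (cS i)) /=; move: iW; rewrite inE.
Qed.

(** All lattice points of the box are packed, with scale 1 and rounding error C = 0. *)
Lemma point_packing (R : realFieldType) (d k s : nat) :
  exists r K : nat, [/\ (0 < r)%N, (0 < K)%N & forall l n : nat, (0 < l)%N ->
  (n * (K * l ^ (s * k).+1) <= l ^ (s * d))%N ->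
  exists p : 'I_n -> {ffun 'I_d -> 'I_(l ^ s)}, injective p /\
    forall W : 'M[R]_(1 + d), (\rank W <= k.+1)%N ->
      (#|[set i | (row_mx 1 (\row_j (p i j)%:R) <= W)%MS]| < r)%N].
Proof.
have [r [K0 [r0 K0p pack]]] := @lattice_packing R d 0 k s.
exists r, K0; split => // l n l0 nl.
pose v (c : {ffun 'I_d -> 'I_(l ^ s)}) := \row_j (c j)%:R : 'rV[R]_d.
have vclose c j : `|1 * v c 0 j - (c j)%:R| <= 0%:R.
  by rewrite mxE mul1r subrr normr0.
have [S [cardS SP]] := pack _ _ _ id v 1 l0 erefl (fun _ _ => id) ler01 vclose.
have nS : (n <= #|S|)%N.
  have K1 : (0 < K0 * l ^ (s * k).+1)%N by rewrite muln_gt0 K0p expn_gt0 l0.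
  rewrite -(leq_pmul2r K1); apply: leq_trans nl (leq_trans _ cardS).
  by rewrite card_ffun !card_ord expnM.
pose p (i : 'I_n) := enum_val (widen_ord nS i).
have pinj : injective p.
  by move=> i j /enum_val_inj/(congr1 val)/= h; apply: val_inj.
exists p; split=> // W /SP; apply: leq_ltn_trans.
rewrite -(card_imset _ pinj); apply/subset_leq_card/subsetP => _ /imsetP[i iW ->].
by rewrite inE (enum_valP (widen_ord nS i)) /=; move: iW; rewrite inE.
Qed.

(** * Incidences between the packed points and hyperplanes *)

(** Leading coefficient 1 makes the equation of a hyperplane unique. The point [x0] separates
    different right-hand sides; if these agree, moving [x0] inside the first hyperplane along e_a -
    h_a e_0 leaves the second one, where a is a coordinate at which the normals differ. *)
Lemma hyp_arrangement_normalized (R : realType) (D m : nat)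
    (H : 'I_m -> 'rV[R]_D.+1 * R) :
  injective H -> (forall j, (H j).1 0 0 = 1) -> hyp_arrangement H.
Proof.
move=> Hinj H1; split=> [j|j j' neq].
  by apply: contraTneq (oner_neq0 R) => H0; rewrite negbK -(H1 j) H0 mxE.
pose x0 : 'rV[R]_D.+1 := (H j).2 *: delta_mx 0 0.
have onE y i : on_hyp y (H i) = (((H i).1 *m y^T) 0 0 == (H i).2).
  by rewrite /on_hyp mxE; congr (_ == _); apply: eq_bigr => a _; rewrite !mxE.
have val0 i : ((H i).1 *m x0^T) 0 0 = (H j).2.
  rewrite /x0 linearZ /= trmx_delta -scalemxAr -colE !mxE H1 mulr1 //.
case: (eqVneq (H j).2 (H j').2) => [e2|ne2]; last first.
  by exists x0; rewrite !onE !val0 eqxx (negPf ne2).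
have [a na] : exists a, (H j).1 0 a != (H j').1 0 a.
  apply/existsP; rewrite -negb_forall; apply: contra neq => /forallP h.
  apply/eqP/Hinj; rewrite [H j]surjective_pairing [H j']surjective_pairing e2.
  by congr (_, _); apply/rowP => a; apply/eqP.
exists (x0 + delta_mx 0 a - (H j).1 0 a *: delta_mx 0 0).
have valE i : ((H i).1 *m (x0 + delta_mx 0 a - (H j).1 0 a *: delta_mx 0 0)^T) 0 0
    = (H j).2 + (H i).1 0 a - (H j).1 0 a.
  have -> : (x0 + delta_mx 0 a - (H j).1 0 a *: delta_mx 0 0)^T =
      x0^T + (delta_mx 0 a)^T - (H j).1 0 a *: (delta_mx 0 0)^T.
    by apply/matrixP => b c; rewrite !mxE.
  rewrite mulmxBr mulmxDr !trmx_delta -scalemxAr -!colE.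
  have -> : forall A B C : 'M[R]_1, (A + B - C) 0 0 = A 0 0 + B 0 0 - C 0 0.
    by move=> A B C; rewrite !mxE.
  by rewrite val0 !mxE H1 mulr1.
rewrite !onE !valE addrK eqxx -e2 eq_sym eqb_id; apply: contra na => /eqP h.
by apply/eqP; lra.
Qed.

Lemma sum_genmx_sub (F : fieldType) (I : finType) (p q n : nat) (u : I -> 'M[F]_(p, n))
    (S : {set I}) (W : 'M[F]_(q, n)) :
  (forall i, i \in S -> (u i <= W)%MS) -> (\sum_(i in S) <<u i>> <= W)%MS.
Proof. by move=> uW; apply/sumsmx_subP => i iS; rewrite genmxE uW. Qed.

Lemma sub_sum_genmx (F : fieldType) (I : finType) (p n : nat) (u : I -> 'M[F]_(p, n))
    (S : {set I}) i :
  i \in S -> (u i <= \sum_(i in S) <<u i>>)%MS.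
Proof. by move=> iS; apply: (sumsmx_sup i) => //; rewrite genmxE. Qed.

(** Incidence of x with h is orthogonality of (1, x) and (-h.2, h.1) in dimension d + 1. Dropping
    the first coordinate maps the span of the latter rows onto that of the normals, so the rank of
    the normals is no larger. *)
Lemma dual_ranks (R : realType) (d n m : nat) (P : 'I_n -> 'rV[R]_d)
    (H : 'I_m -> 'rV[R]_d * R) (A : {set 'I_n}) (B : {set 'I_m}) :
  (forall i j, i \in A -> j \in B -> on_hyp (P i) (H j)) ->
  (\rank (\sum_(i in A) <<row_mx 1 (P i) : 'rV_(1 + d)>>) +
   \rank (\sum_(j in B) <<(H j).1>>) <= d.+1)%N.
Proof.
move=> PH; pose g j : 'rV[R]_(1 + d) := row_mx (- ((H j).2)%:M) (H j).1.
set U := (\sum_(i in A) _)%MS; set V := (\sum_(j in B) _)%MS.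
pose G := (\sum_(j in B) <<g j>>)%MS.
have VG : (\rank V <= \rank G)%N.
  apply: leq_trans (mxrankM_maxl G (col_mx 0 1%:M : 'M_(1 + d, d))).
  apply/mxrankS/sum_genmx_sub => j jB.
  have -> : (H j).1 = g j *m col_mx 0 1%:M by rewrite mul_row_col mulmx0 add0r mulmx1.
  by apply/submxMr/sub_sum_genmx.
have UG : U *m G^T = 0.
  apply/sub_kermxP/sum_genmx_sub => i iA; apply/sub_kermxP.
  apply/trmx_inj; rewrite trmx_mul trmxK trmx0.
  apply/sub_kermxP/sum_genmx_sub => j jB; apply/sub_kermxP.
  rewrite tr_row_mx mul_row_col trmx1 mulmx1; apply/matrixP => a b.
  rewrite !ord1 !mxE /= mulr1n addrC; apply/eqP; rewrite subr_eq0.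
  move: (PH i j iA jB); rewrite /on_hyp; congr (_ == _).
  by apply: eq_bigr => c _; rewrite !mxE.
apply: leq_trans (leq_add (leqnn _) VG) _.
rewrite -(mxrank_tr G); exact: (mulmx0_rank_max UG).
Qed.

(* The hyperplanes w i . x = z / q i with 0 <= z < D.+1 * (T * X) carry all the
   incidences; the others have negative right-hand side and avoid the points. *)
Lemma incidences_of_packings (R : realType) (D k n m r N X T : nat)
    (p : 'I_n -> {ffun 'I_D.+1 -> 'I_X}) (w : 'I_N -> 'rV[R]_D.+1)
    (q : 'I_N -> nat) (a : 'I_N -> 'I_D -> nat) :
  (k < D)%N -> (0 < r)%N -> injective w ->
  (forall i, [/\ w i = row_mx 1 (\row_j ((a i j)%:R / (q i)%:R)) :> 'rV_(1 + D),
                 (0 < q i <= T)%N & forall j, (a i j <= q i)%N]) ->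
  (forall W : 'M[R]_(1 + D.+1), (\rank W <= k.+1)%N ->
      (#|[set i | (row_mx 1 (\row_j (p i j)%:R) <= W)%MS]| < r)%N) ->
  (forall W : 'M[R]_D.+1, (\rank W <= D - k)%N -> (#|[set i | (w i <= W)%MS]| < r)%N) ->
  (N * (D.+1 * (T * X)) <= m)%N ->
  exists H : 'I_m -> 'rV[R]_D.+1 * R,
    let P i := \row_j (p i j)%:R in
    hyp_arrangement H /\ ~ Krr_sub r P H /\ (n * N <= inc P H)%N.
Proof.
move=> kD r0 winj wE pflat wflat Nm; set b := (D.+1 * (T * X))%N in Nm.
pose P i : 'rV[R]_D.+1 := \row_j (p i j)%:R.
(* Indices are cut into blocks of length [b], one per normal, and the position in the block is the
   numerator z; beyond the N blocks the value is [None]. *)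
pose idx (j : 'I_m) : option 'I_N := insub (j %/ b)%N.
pose H (j : 'I_m) : 'rV[R]_D.+1 * R :=
  if idx j is Some i then (w i, (j %% b)%N%:R / (q i)%:R)
  else (delta_mx 0 0, - (j.+1)%:R).
have q0 i : 0 < (q i)%:R :> R by rewrite ltr0n; have [_ /andP[]] := wE i.
have w0 i : w i 0 0 = 1.
  have [-> _ _] := wE i.
  by rewrite mxE; case: splitP => [c _|//]; rewrite mxE !ord1.
have wS i j : w i 0 (lift ord0 j) = (a i j)%:R / (q i)%:R.
  have [-> _ _] := wE i; rewrite mxE; case: splitP => c; rewrite lift0.
    by rewrite ord1.
  by case=> /val_inj <-; rewrite mxE.
have H0 j : (H j).1 0 0 = 1.
  by rewrite /H; case: (idx j) => [i|] //=; rewrite mxE !eqxx.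
have Hinj : injective H.
  move=> j j'; rewrite /H; case E: (idx j) => [i|]; case E': (idx j') => [i'|].
  - case=> /winj ei; subst i' => /(mulIf (invr_neq0 (lt0r_neq0 (q0 i)))) /eqP.
    rewrite eqr_nat => /eqP em; apply: val_inj => /=.
    rewrite (divn_eq j b) (divn_eq j' b) em; congr (_ * _ + _)%N.
    move: E E'; rewrite /idx; case: insubP => // _ _ <- [->].
    by case: insubP => // _ _ <- [->].
  - case=> _ /eqP; rewrite gt_eqF // (lt_le_trans (y := 0)) ?oppr_lt0 ?ltr0n //.
    by rewrite divr_ge0 ?ler0n.
  - case=> _ /eqP; rewrite lt_eqF // (lt_le_trans (y := 0)) ?oppr_lt0 ?ltr0n //.
    by rewrite divr_ge0 ?ler0n.
  - by case=> /oppr_inj/eqP; rewrite eqr_nat eqSS => /eqP h; apply: val_inj.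
have onE i (h : 'rV[R]_D.+1 * R) : on_hyp (P i) h =
    (h.1 0 0 * (p i ord0)%:R + \sum_j h.1 0 (lift ord0 j) * (p i (lift ord0 j))%:R
       == h.2 :> R).
  by rewrite /on_hyp big_ord_recl mxE; congr (_ + _ == _); apply: eq_bigr => j _; rewrite mxE.
have on_idx i j : on_hyp (P i) (H j) -> idx j.
  rewrite onE /H; case: (idx j) => //=; rewrite mxE !eqxx big1 => [|c _]; last first.
    by rewrite mxE mul0r.
  by rewrite mul1r addr0 -addr_eq0 -natrD pnatr_eq0 addnS.
exists H => P'; split; first exact: hyp_arrangement_normalized.
split.
  move=> [A [B [cardA [cardB AB]]]].
  have [i0 i0A] : exists i0, i0 \in A by apply/set0Pn; rewrite -card_gt0 cardA.
  have rkA : (k.+1 < \rank (\sum_(i in A) <<row_mx 1 (P' i) : 'rV_(1 + D.+1)>>)%MS)%N.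
    rewrite ltnNge; apply/negP => /pflat; apply/negP; rewrite -leqNgt -cardA.
    apply/subset_leq_card/subsetP => i iA; rewrite inE.
    exact: (sub_sum_genmx (fun i => row_mx 1 (P' i) : 'rV_(1 + D.+1))).
  have rkB : (D - k < \rank (\sum_(j in B) <<(H j).1>>)%MS)%N.
    rewrite ltnNge; apply/negP => /wflat; apply/negP; rewrite -leqNgt -cardB.
    have someB j : j \in B -> idx j by move=> jB; exact: on_idx (AB i0 j i0A jB).
    (* Parallel hyperplanes through the common point [P i0] coincide, so the members of [B] have
       different normals. *)
    have idx_inj : {in B &, injective idx}.
      move=> j j' jB j'B e; apply: Hinj.
      have e1 : (H j).1 = (H j').1.
        by rewrite /H e; have := someB j' j'B; case: (idx j').
      have /eqP h := AB i0 j i0A jB; have /eqP h' := AB i0 j' i0A j'B.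
      by rewrite [H j]surjective_pairing [H j']surjective_pairing -h -h' e1.
    rewrite -(card_in_imset idx_inj) -[X in (_ <= X)%N](card_imset _ Some_inj).
    apply/subset_leq_card/subsetP => _ /imsetP[j jB ->].
    have HjV : ((H j).1 <= \sum_(j in B) <<(H j).1>>)%MS.
      exact: (sub_sum_genmx (fun j => (H j).1)).
    move: HjV (someB j jB); rewrite {1}/H; case: (idx j) => // c /= wc _.
    by apply: imset_f; rewrite inE.
  have := dual_ranks AB; lia.
(* This is q_c times the inner product of [w c] with point i: a sum of D + 1 terms, each below T
   X. *)
pose z i c := (q c * p i ord0 + \sum_j a c j * p i (lift ord0 j))%N.
have zb i c : (z i c < b)%N.
  have [_ /andP[qc0 qcT] ac] := wE c.
  have T0 : (0 < T)%N by exact: leq_trans qc0 qcT.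
  rewrite /b mulSn -addSn; apply: leq_add.
    by apply: (@leq_ltn_trans (T * p i ord0)%N); rewrite ?leq_mul2r ?qcT ?orbT ?ltn_pmul2l.
  rewrite -[X in (_ <= X * _)%N]card_ord -sum_nat_const; apply: leq_sum => j _.
  by rewrite leq_mul ?(leq_trans (ac j)) // ltnW.
have jm (i : 'I_n) (c : 'I_N) : (c * b + z i c < m)%N.
  apply: leq_trans Nm; apply: (@leq_trans (c.+1 * b)%N).
    by rewrite mulSn addnC ltn_add2r.
  by rewrite leq_mul2r ltn_ord orbT.
pose f (ic : 'I_n * 'I_N) : 'I_n * 'I_m := (ic.1, Ordinal (jm ic.1 ic.2)).
have divE (i : 'I_n) (c : 'I_N) : ((c * b + z i c) %/ b = c)%N.
  by rewrite divnMDl ?(leq_trans _ (zb i c)) // divn_small ?addn0.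
have finj : injective f.
  move=> [i c] [i' c'] [] /= <- e; congr (_, _); apply: val_inj => /=.
  by rewrite -(divE i c) e divE.
have -> : (n * N = #|{: 'I_n * 'I_N}|)%N by rewrite card_prod !card_ord.
rewrite -cardsT -(card_imset _ finj); apply/subset_leq_card/subsetP => _ /imsetP[[i c] _ ->].
rewrite inE /= onE /H /idx /= divE; case: insubP => [c' _ /val_inj ->|]; last by rewrite ltn_ord.
rewrite modnMDl modn_small //= w0 mul1r; apply/eqP.
apply: (mulIf (lt0r_neq0 (q0 c))); rewrite divfK ?lt0r_neq0 // mulrDl mulr_suml.
rewrite /z natrD natrM mulrC natr_sum; congr (_ + _); apply: eq_bigr => j _.
by rewrite wS natrM mulrAC divfK ?lt0r_neq0.
Qed.

(** * Choice of the parameters for given n and m *)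

(** The parallel hyperplanes x_0 = j with all points on the last axis; D > 0 keeps that axis inside
    x_0 = 0. *)
Lemma single_hyperplane_incidences (R : realType) (D n m : nat) :
  (0 < D)%N -> (0 < m)%N ->
  exists (P : 'I_n -> 'rV[R]_D.+1) (H : 'I_m -> 'rV[R]_D.+1 * R),
    [/\ injective P, hyp_arrangement H, (n <= inc P H)%N &
        forall i j j', on_hyp (P i) (H j) -> on_hyp (P i) (H j') -> j = j'].
Proof.
move=> D0 m0.
pose P (i : 'I_n) : 'rV[R]_D.+1 := (i%:R : R) *: delta_mx 0 ord_max.
pose H (j : 'I_m) : 'rV[R]_D.+1 * R := (delta_mx 0 ord0, (j%:R : R)).
have natI N : injective (fun i : 'I_N => i%:R : R).
  by move=> i j /eqP; rewrite eqr_nat => /eqP/val_inj.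
have onE i j : on_hyp (P i) (H j) = (j == 0 :> nat).
  rewrite /on_hyp big1 => [|c _]; last first.
    rewrite !mxE /=; case: (eqVneq c 0) => [->|_]; last by rewrite mul0r.
    have -> : (0 == ord_max :> 'I_D.+1) = false by case: (D) D0.
    by rewrite !mulr0.
  by rewrite eq_sym pnatr_eq0.
exists P, H; split.
- move=> i i' /(congr1 (fun x : 'rV[R]_D.+1 => x 0 ord_max)).
  by rewrite !mxE !eqxx !mulr1 => /natI.
- apply: hyp_arrangement_normalized => [j j' [/natI]//|j].
  by rewrite mxE !eqxx.
- pose f (i : 'I_n) : 'I_n * 'I_m := (i, Ordinal m0).
  have finj : injective f by move=> i i' [].
  rewrite -[X in (X <= _)%N](card_ord n) -cardsT -(card_imset _ finj).
  by apply/subset_leq_card/subsetP => _ /imsetP[i _ ->]; rewrite inE /= onE.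
by move=> i j j'; rewrite !onE => /eqP e /eqP e'; apply: val_inj; rewrite /= e e'.
Qed.

Lemma Krr_subS (R : realType) (d n m r r' : nat) (P : 'I_n -> 'rV[R]_d)
    (H : 'I_m -> 'rV[R]_d * R) :
  (r <= r')%N -> Krr_sub r' P H -> Krr_sub r P H.
Proof.
have sub (T : finType) (A : {set T}) a : (a <= #|A|)%N ->
    exists B : {set T}, B \subset A /\ #|B| = a.
  move=> aA; have : (0 < #|[set B : {set T} | B \subset A & #|B| == a]|)%N.
    by rewrite cards_draws bin_gt0.
  by rewrite card_gt0 => /set0Pn[B]; rewrite inE => /andP[? /eqP]; exists B.
move=> rr' [A [B [cA [cB AB]]]].
have [|A' [sA cA']] := sub _ A r; first by rewrite cA.
have [|B' [sB cB']] := sub _ B r; first by rewrite cB.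
exists A', B'; split=> //; split=> // i j /(subsetP sA) iA /(subsetP sB) jB.
exact: AB.
Qed.

(* l ^ s is the side of the box containing P, and t ^ (s * D) bounds the height
   of the normals; t is maximal such that all hyperplanes needed number at most m.
   If not even t = 1 is possible, one hyperplane contains all points. *)
Lemma incidence_construction (R : realType) (D k s : nat) :
  (k < D)%N -> (0 < s)%N ->
  let g := (s * (D.+1 - k) - 1)%N in
  let F := (D.+1 * (s * k.+1 - 1))%N in
  exists r C : nat, (0 < C)%N /\ forall n m : nat, (0 < n)%N -> (0 < m)%N ->
  exists (P : 'I_n -> 'rV[R]_D.+1) (H : 'I_m -> 'rV[R]_D.+1 * R),
    [/\ injective P, hyp_arrangement H, ~ Krr_sub r P H &
    exists l t : nat, [/\ (0 < l)%N && (0 < t)%N, (l ^ g <= C * n)%N,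
      (m <= C * (t ^ (F + s * D) * l ^ s))%N & (n * t ^ F <= C * inc P H)%N]].
Proof.
move=> kD s0 g F; set E := (F + s * D)%N.
have eD : (D - k.+1 < D)%N by rewrite ltn_subrL (leq_ltn_trans _ kD).
have D0 : (0 < D)%N by exact: leq_ltn_trans kD.
have [r1 [K1 [K1p normals]]] := @normal_packing R D (D - k.+1) s eD s0.
have [r2 [K2 [r2p K2p points]]] := point_packing R D.+1 k s.
have g0 : (0 < g)%N.
  rewrite subn_gt0; apply: leq_trans (leq_pmull _ s0).
  by rewrite subSn ?ltnS ?subn_gt0 // ltnW.
have sE : (s * (D - (D - k.+1)) - 1 = s * k.+1 - 1)%N by rewrite subKn.
(* The summand 2 in r serves the parallel family, which has no K_{2,2}. The powers of 2 in C come
   from the least l and the greatest t: passing to a neighbouring integer costs at most a factor 2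
   in the base. *)
exists (r1 + r2 + 2)%N, (2 ^ g * K2 + D.+1 * 2 ^ E + K1)%N.
set C := (_ + K1)%N.
have C0 : (0 < C)%N by rewrite addn_gt0 K1p orbT.
split=> // n m n0 m0.
have Pex : exists l, (n * K2 <= l ^ g)%N.
  exists (n * K2)%N; rewrite -[X in (X <= _)%N]expn1 leq_pexp2l //.
  by rewrite muln_gt0 n0.
case: (ex_minnP Pex) => l lP lmin.
have l0 : (0 < l)%N.
  rewrite lt0n; apply: contraL lP => /eqP ->.
  by rewrite exp0n // -ltnNge muln_gt0 n0.
have lle : (l ^ g <= C * n)%N.
  apply: (@leq_trans (2 ^ g * K2 * n)%N); last first.
    by rewrite leq_mul2r /C -addnA leq_addr orbT.
  case: l l0 lP lmin => // [[_ _ _|l _ _ lmin]].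
    by rewrite exp1n !muln_gt0 expn_gt0 K2p n0.
  have : (l.+1 ^ g <= n * K2)%N.
    rewrite leqNgt; apply/negP => /ltnW/lmin.
    by rewrite ltnn.
  move=> h; rewrite -mulnA [(K2 * n)%N]mulnC; apply: leq_trans (leq_mul (leqnn _) h).
  by rewrite -expnMn leq_exp2r //; lia.
case: (ltnP m (D.+1 * l ^ s)) => mle.
  have [P [H [Pinj Harr Pinc Huniq]]] := single_hyperplane_incidences R n D0 m0.
  exists P, H; split=> //.
    move=> /(@Krr_subS _ _ _ _ 2 _ _ _ (leq_addl _ _)) [A [B [cA [cB AB]]]].
    have [i iA] : exists i, i \in A by apply/set0Pn; rewrite -card_gt0 cA.
    have : (1 < #|B|)%N by rewrite cB.
    case/card_gt1P => j [j' [jB j'B]]; apply/negP; rewrite negbK; apply/eqP.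
    exact: Huniq (AB i j iA jB) (AB i j' iA j'B).
  exists l, 1%N; split=> //; first by rewrite l0.
    apply: leq_trans (ltnW mle) _; rewrite exp1n mul1n leq_mul2r; apply/orP; right.
    apply: (@leq_trans (D.+1 * 2 ^ E)%N); first by rewrite leq_pmulr ?expn_gt0.
    by rewrite /C addnAC leq_addl.
  by rewrite exp1n muln1; apply: leq_trans Pinc _; rewrite leq_pmull.
pose Q t := (D.+1 * (t ^ E * l ^ s) <= m)%N.
have Qex : exists t, Q t by exists 1%N; rewrite /Q exp1n mul1n.
have ls0 : (0 < l ^ s)%N by rewrite expn_gt0 l0.
have E0 : (0 < E)%N by rewrite addn_gt0 !muln_gt0 s0 D0 orbT.
have Qb t : Q t -> (t <= m)%N.
  apply: leq_trans; apply: leq_trans (leq_pmull _ _) => //.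
  apply: leq_trans (leq_pmulr _ ls0).
  by case: t => // t; rewrite -[X in (X <= _)%N]expn1 leq_pexp2l.
case: (ex_maxnP Qex Qb) => t tP tmax.
have t0 : (0 < t)%N by apply: tmax; rewrite /Q exp1n mul1n.
have [N [w [q [a [N_ge N_le winj wE wflat]]]]] := normals t t0.
rewrite sE -/F in N_ge N_le.
(* The -1 in [g] makes room for the extra factor l in the number of colours: g + (s k + 1) =
   s(D+1). *)
have [|p [pinj pflat]] := points l n l0.
  rewrite mulnA; apply: leq_trans (leq_mul lP (leqnn _)) _.
  rewrite -expnD; apply/eq_leq; congr (_ ^ _)%N.
  have : (s * (D.+1 - k) + s * k = s * D.+1)%N.
    by rewrite -mulnDr subnK // ltnW // ltnW.
  by move: g0; rewrite /g; lia.
have [||||H [Harr [HK Hinc]]] := @incidences_of_packings R D k n m (r1 + r2)%N N _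
    (t ^ (s * D))%N p w q a kD _ winj wE _ _ _.
- by rewrite addn_gt0 r2p orbT.
- by move=> W /pflat h; apply: leq_trans h (leq_addl _ _).
- move=> W rkW; have : (\rank W <= (D - k.+1).+1)%N by rewrite subnSK.
  by move=> /wflat h; apply: leq_trans h (leq_addr _ _).
- apply: leq_trans (leq_mul N_le (leqnn _)) (leq_trans _ tP).
  by rewrite mulnCA /E expnD !mulnA.
exists (fun i => \row_j (p i j)%:R), H; split=> //.
- move=> i i' /rowP h; apply: pinj; apply/ffunP => j; apply: val_inj.
  by move: (h j); rewrite !mxE => /eqP; rewrite eqr_nat => /eqP.
- by move=> /(Krr_subS (leq_addr _ _)).
exists l, t; split=> //; first by rewrite l0.
  have : (m <= D.+1 * (t.+1 ^ E * l ^ s))%N.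
    by rewrite leqNgt; apply/negP => /ltnW/tmax; rewrite ltnn.
  move/leq_trans; apply; rewrite mulnA [in leqRHS]mulnA leq_mul2r; apply/orP; right.
  apply: (@leq_trans (D.+1 * 2 ^ E * t ^ E)%N).
    rewrite -mulnA leq_mul2l -expnMn leq_exp2r //; lia.
  by rewrite leq_mul2r /C; apply/orP; right; lia.
apply: (@leq_trans (n * (K1 * N))%N); first by rewrite leq_mul2l N_ge orbT.
rewrite mulnCA; apply: leq_mul => //; exact: leq_addl.
Qed.

(** * Exponents and the final bound *)

(** As s grows, F/E tends to b = A/(A + d - 1) with A = d(k+1), and s/g to 1/(d-k). The stated
    fractions are 1 - b and b/(d-k), and in both claims the error is at most 1/s <= eps. *)
Lemma incidence_exponents (R : realFieldType) (d k s eps : R) :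
  0 <= k -> k + 2 <= d -> 1 <= s -> 1 <= s * eps ->
  let F := d * (s * (k + 1) - 1) in
  let E := F + s * (d - 1) in
  let g := s * (d - k) - 1 in
  1 - (d - 1) / (d * k + 2 * d - 1) - eps <= F / E /\
  1 - (k + 1) / ((k + 2 - d^-1) * (d - k)) - eps <= 1 - s / g * (F / E).
Proof.
move=> k0 kd s1 seps F E g; pose A := d * (k + 1); pose b := A / (A + (d - 1)).
have d0 : 0 < d by lra.
have s0 : 0 < s by lra.
have dA : d <= A by rewrite /A ler_peMr; lra.
have FE : F = s * A - d by rewrite /F /A; ring.
have sA : s * d <= s * A by rewrite ler_pM2l.
have sd : d <= s * d by rewrite ler_peMl // ltW.
have F0 : 0 <= F by lra.
have sd1 : 0 < s * (d - 1) by rewrite mulr_gt0 //; lra.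
have E0 : 0 < E by rewrite /E; lra.
have AD0 : 0 < A + (d - 1) by lra.
have sq : s <= s * (d - k - 1) by rewrite ler_peMr //; lra.
have gs : s <= g by rewrite /g; lra.
have q0 : 0 < d - k by lra.
have g0 : 0 < g by apply: lt_le_trans gs.
have seps' : s^-1 <= eps by rewrite -[leLHS]mul1r ler_pdivrMr // mulrC.
have b1 : b <= 1 by rewrite /b ler_pdivrMr //; lra.
have b0 : 0 <= b by rewrite divr_ge0; lra.
have FEb : F / E = b - d * (d - 1) / ((A + (d - 1)) * E).
  rewrite /b /E FE; field; rewrite -FE -/E; apply/andP; split; apply/lt0r_neq0 => //.
have err0 : 0 <= d * (d - 1) / ((A + (d - 1)) * E).
  by rewrite divr_ge0 ?mulr_ge0; lra.
have err : d * (d - 1) / ((A + (d - 1)) * E) <= s^-1.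
  rewrite ler_pdivrMr ?mulr_gt0 // [leRHS]mulrC ler_pdivlMr //.
  rewrite -mulrA [_ * s]mulrC; apply: ler_pM; rewrite /E; lra.
have sg : s / g <= (d - k)^-1 + s^-1.
  have -> : s / g = (d - k)^-1 + ((d - k) * g)^-1.
    by rewrite /g; field; rewrite -/g !lt0r_neq0.
  rewrite lerD2l lef_pV2 ?posrE ?mulr_gt0 //.
  by apply: le_trans gs _; rewrite ler_peMl ?ltW //; lra.
have sg0 : 0 <= s / g by rewrite divr_ge0 ?ltW.
have -> : (d - 1) / (d * k + 2 * d - 1) = 1 - b.
  by rewrite /b /A; field; rewrite -/A lt0r_neq0.
have -> : (k + 1) / ((k + 2 - d^-1) * (d - k)) = b * (d - k)^-1.
  by rewrite /b /A; field; rewrite -/A !lt0r_neq0.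
split; first by lra.
suff : s / g * (F / E) <= b * (d - k)^-1 + s^-1 by lra.
apply: (@le_trans _ _ (((d - k)^-1 + s^-1) * b)).
  by apply: ler_pM => //; [rewrite divr_ge0 // ltW | lra].
rewrite mulrDl [b * _]mulrC lerD2l ler_piMr // invr_ge0; lra.
Qed.

(** Eliminates l and t: l^s <= (C n)^psi bounds m^phi by a constant times t^F n^(psi phi), hence
    n^(1 - psi phi) m^phi by a constant times n t^F. Since n, m >= 1, smaller exponents [a] and [b]
    only decrease the left side. *)
Lemma incidence_bound (R : realType) (C n m i l t g F E s : nat) (a b : R) :
  (0 < C)%N -> (0 < n)%N -> (0 < m)%N -> (0 < g)%N -> (0 < E)%N ->
  (l ^ g <= C * n)%N -> (m <= C * (t ^ E * l ^ s))%N -> (n * t ^ F <= C * i)%N ->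
  let phi := F%:R / E%:R : R in let psi := s%:R / g%:R : R in
  a <= 1 - psi * phi -> b <= phi ->
  ((C%:R `^ (phi + psi * phi)) * C%:R)^-1 * (n%:R `^ a * m%:R `^ b) <= i%:R.
Proof.
move=> C0 n0 m0 g0 E0 lg mt ni phi psi ale ble.
have CR : 0 < C%:R :> R by rewrite ltr0n.
have nR : 0 < n%:R :> R by rewrite ltr0n.
have phi0 : 0 <= phi by rewrite divr_ge0 ?ler0n.
have psi0 : 0 <= psi by rewrite divr_ge0 ?ler0n.
have rootE (x u v : nat) : (0 < v)%N -> (x%:R ^+ u : R) = (x%:R ^+ v) `^ (u%:R / v%:R).
  move=> v0; rewrite -!powR_mulrn ?ler0n // -powRrM mulrCA divff ?mulr1 //.
  by rewrite pnatr_eq0 -lt0n.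
have ls : l%:R ^+ s <= (C%:R * n%:R) `^ psi :> R.
  rewrite (rootE _ _ _ g0); apply: (ge0_ler_powR psi0);
    rewrite ?nnegrE ?exprn_ge0 ?mulr_ge0 ?ler0n //.
  by rewrite -natrX -natrM ler_nat.
have mphi : m%:R `^ phi <= C%:R `^ (phi + psi * phi) * t%:R ^+ F * n%:R `^ (psi * phi) :> R.
  apply: le_trans (_ : (C%:R * (t%:R ^+ E * (C%:R * n%:R) `^ psi)) `^ phi <= _).
    apply: (ge0_ler_powR phi0);
      rewrite ?nnegrE ?mulr_ge0 ?exprn_ge0 ?powR_ge0 ?ler0n //.
    apply: le_trans (_ : (C * (t ^ E * l ^ s))%:R <= _); first by rewrite ler_nat.
    by rewrite !natrM !natrX ler_pM2l // ler_wpM2l ?exprn_ge0 ?ler0n.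
  rewrite !powRM ?mulr_ge0 ?exprn_ge0 ?powR_ge0 ?ler0n // -!powRrM -(rootE _ _ _ E0).
  rewrite powRD ?(gt_eqF CR) ?implybT //.
  by rewrite le_eqVlt; apply/orP; left; apply/eqP; ring.
rewrite ler_pdivrMl ?mulr_gt0 ?powR_gt0 //.
apply: le_trans (_ : n%:R `^ (1 - psi * phi) * m%:R `^ phi <= _).
  by apply: ler_pM; rewrite ?powR_ge0 ?ler_powR ?ler1n.
apply: le_trans (ler_wpM2l (powR_ge0 _ _) mphi) _.
rewrite mulrCA -powRD ?(gt_eqF nR) ?implybT // subrK powRr1 ?ler0n //.
rewrite -!mulrA ler_pM2l ?powR_gt0 // mulrC -natrX -!natrM.
by rewrite ler_nat.
Qed.

Theorem theorem7 (R : realType) (d k : nat) (eps : R) :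
  (k + 2 <= d)%N -> 0 < eps < 1 ->
  exists (r : nat) (c : R), 0 < c /\
    forall n m : nat, (0 < n)%N -> (0 < m)%N ->
    exists (P : 'I_n -> 'rV[R]_d) (H : 'I_m -> 'rV[R]_d * R),
      injective P /\ hyp_arrangement H /\ ~ Krr_sub r P H /\
      c * ((n%:R) `^ (1 - (k%:R + 1) / ((k%:R + 2 - d%:R^-1) * (d%:R - k%:R)) - eps)
           * (m%:R) `^ (1 - (d%:R - 1) / (d%:R * k%:R + 2 * d%:R - 1) - eps))
        <= (inc P H)%:R.
Proof.
case: d => [|D kD /andP[eps0 _]]; first by rewrite addn2.
(* The exponents lose at most 1/s, so s is chosen above 1/eps. *)
have [s epss] : exists s : nat, eps^-1 < s%:R.
  by exists (Num.bound eps^-1); rewrite archi_boundP // invr_ge0 ltW.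
have s0 : (0 < s)%N by rewrite -(ltr0n R); apply: le_lt_trans epss; rewrite invr_ge0 ltW.
have seps : 1 <= s%:R * eps by rewrite -ler_pdivrMr // div1r ltW.
have kD' : (k < D)%N by rewrite addn2 in kD.
have [r [C [C0 HC]]] := @incidence_construction R D k s kD' s0.
have kdR : k%:R + 2 <= D.+1%:R :> R by rewrite -natrD ler_nat.
have s1R : 1 <= s%:R :> R by rewrite ler1n.
have [ble ale] := incidence_exponents (ler0n R k) kdR s1R seps.
set phi := (X in _ <= X) in ble; set psi := s%:R / _ in ale.
have sk : (0 < s * k.+1)%N by rewrite muln_gt0 s0.
have sDk : (1 < s * (D.+1 - k))%N.
  by apply: leq_trans (leq_pmull _ s0); rewrite subSn ?ltnS ?subn_gt0 // ltnW.
have gE : (s * (D.+1 - k) - 1)%:R = s%:R * (D.+1%:R - k%:R) - 1 :> R.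
  rewrite natrB; last exact: ltnW sDk.
  by rewrite natrM natrB // ltnW // ltnW.
have FE : (D.+1 * (s * k.+1 - 1))%:R = D.+1%:R * (s%:R * (k%:R + 1) - 1) :> R.
  rewrite natrM natrB; last exact: sk.
  by rewrite natrM natr1.
have EE : (D.+1 * (s * k.+1 - 1) + s * D)%:R =
    D.+1%:R * (s%:R * (k%:R + 1) - 1) + s%:R * (D.+1%:R - 1) :> R.
  have -> : D.+1%:R - 1 = D%:R :> R by rewrite -natr1 addrK.
  by rewrite natrD FE natrM.
exists r, (C%:R `^ (phi + psi * phi) * C%:R)^-1; split.
  have CR : 0 < C%:R :> R by rewrite ltr0n.
  by rewrite invr_gt0 mulr_gt0 // powR_gt0.
move=> n m n0 m0; have [P [H [Pinj Harr HK [l [t [_ lg mt nt]]]]]] := HC n m n0 m0.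
exists P, H; do 3 split => //.
move: ale ble; rewrite /phi /psi -gE -EE -FE => ale ble.
by apply: (incidence_bound C0 n0 m0 _ _ lg mt nt ale ble);
  rewrite ?subn_gt0 // addn_gt0 !muln_gt0 s0 (leq_ltn_trans _ kD') ?orbT.
Qed.
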